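(* There is an arithmetic term $$V(N,x_+,x_-,y_+,y_-,u,w_+,w_-,v_+,v_-,t,a,b)$$ that computes the color of points for Julia sets, in the following sense. Let all arguments be natural numbers with $u,t,a,b\ge 1$, and put $$z(0)=\frac{(x_+-x_-)+i(y_+-y_-)}{u},\qquad c=\frac{(w_+-w_-)+i(v_+-v_-)}{t},\qquad R=\frac{a}{b}.$$ If $R^2-R\ge|c|$ and $|z(0)|<R$, then the value of the term is the color of $z(0)$ with respect to $c$, $R$ and $N$. Moreover, putting $z(0)=0$ (i.e. $x_+=x_-=y_+=y_-=0$, $u=1$) and $R=2$ (i.e. $a=2$, $b=1$), and regarding $c$ as a variable, the same term produces the coloring of the Mandelbrot set, i.e. its value is the color of $z(0)=0$ with respect to $c$, $2$ and $N$.
   Context: $\mathbb{N}=\{0,1,2,\dots\}$. An arithmetic term is a finite expression built from variables ranging over $\mathbb{N}$ and natural-number constants by composing addition $x+y$, truncated subtraction $x \dot{-} y=\max(x-y,0)$, multiplication, $\lfloor x/y\rfloor$, $x \bmod y$, and exponentiation $x^y$ (conventions: $x \bmod 0 = x$; for definiteness $\lfloor x/0\rfloor=0$, $0^0=1$). Color: given $c\in\mathbb{C}$, $R>0$, $N\in\mathbb{N}$ and $z(0)\in\mathbb{C}$ with $|z(0)|<R$, let $z(n)=z(n-1)^2+c$ for $n\ge1$. The color of $z(0)$ is the least $n$ with $0\le n\le N$ and $|z(n)|\ge R$ if such an $n$ exists; otherwise (if $z(N)$ is still in the open disk of radius $R$) the color is $N$. *)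

(* Defs.v *)
From mathcomp Require Import all_boot all_order all_algebra.
From mathcomp Require Import reals complex.

Set Implicit Arguments.
Unset Strict Implicit.
Unset Printing Implicit Defensive.

Import Order.TTheory GRing.Theory Num.Theory.

Local Open Scope ring_scope.
Local Open Scope complex_scope.

Inductive aterm (k : nat) : Type :=
  | AVar of 'I_k
  | AConst of nat
  | AAdd of aterm k & aterm k
  | ASub of aterm k & aterm k
  | AMul of aterm k & aterm k
  | ADiv of aterm k & aterm k
  | AMod of aterm k & aterm k
  | APow of aterm k & aterm k.

(* In ssrnat, x - y is truncated, x %/ 0 = 0, x %% 0 = x and 0 ^ 0 = 1. *)
Fixpoint aeval (k : nat) (v : k.-tuple nat) (e : aterm k) : nat :=
  match e with
  | AVar i => tnth v i
  | AConst n => n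
  | AAdd e1 e2 => (aeval v e1 + aeval v e2)%N
  | ASub e1 e2 => (aeval v e1 - aeval v e2)%N
  | AMul e1 e2 => (aeval v e1 * aeval v e2)%N
  | ADiv e1 e2 => (aeval v e1 %/ aeval v e2)%N
  | AMod e1 e2 => (aeval v e1 %% aeval v e2)%N
  | APow e1 e2 => (aeval v e1 ^ aeval v e2)%N
  end.

Definition orbit_pt (R : rcfType) (c z0 : R[i]) (n : nat) : R[i] :=
  iter n (fun z => z ^+ 2 + c) z0.

(* The norm of R[i] is R[i]-valued, whence the injection r%:C. *)
Definition escaped (R : rcfType) (c : R[i]) (r : R) (z0 : R[i]) : pred nat :=
  fun n => r%:C <= `|orbit_pt c z0 n|.

(* As iota 0 N.+1 is 0, ..., N, the index k returned by find is the least
   escaping n <= N, and k = N.+1 if there is none. *)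
Definition color (R : rcfType) (c : R[i]) (r : R) (N : nat) (z0 : R[i]) : nat :=
  let k := find (escaped c r z0) (iota 0 N.+1) in
  if (k <= N)%N then k else N.

Definition gauss_frac (R : rcfType) (p q r s d : nat) : R[i] :=
  ((p%:R - q%:R) +i* (r%:R - s%:R)) / d%:R.

(* Main.v *)
Require Import Defs.
From mathcomp Require Import all_boot all_order all_algebra.
From mathcomp Require Import reals complex boolp zify ring.

(* Once |z(n)| >= R, all later points also have modulus >= R, because |c| <= R^2 - R (or, in
   the Mandelbrot case with |c| > 2, because |z(n)| >= |c| for n >= 1); hence the color is the
   number of n < N with |z(n)| < R. The orbit, written over natural numbers with a common
   denominator, is a recursion with an explicit bound, so it remains to see that arithmetic
   terms are closed under bounded sums (Mazzanti, Marchenkov): a bounded recursion then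
   follows by summing over the numbers W whose digits pass a local check.

   For the bounded sum, a term is first expressed as the number of zeros, in a cube [0, M)^m,
   of a difference E >= 0 of polynomials in the variables and in 2^variable. The zeros are
   then counted at once: sums of powers X^position times E over the cube expand
   into products of sums sum_i i^a q^i, which have closed forms, and multiplying the result by
   2^L - 1 yields a number whose blocks of 2 L bits contain L ones if E <> 0 and none if E = 0. The
   number of ones of n is the 2-adic valuation of 'C(2n, n), and both the binomial and the
   gcd that extracts the power of 2 are digits of explicit numbers. *)

Set Implicit Arguments.
Unset Strict Implicit.
Unset Printing Implicit Defensive.

(** * Arithmetic terms and geometric sums *)

Definition env := nat -> nat.

(** Terms are identified with the functions they compute, so substitution is composition. Remainders
    and general powers are derived below from powers of 2. *)
Inductive term : (env -> nat) -> Prop :=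
  | term_const n : term (fun=> n)
  | term_var i : term (fun e => e i)
  | term_add f g : term f -> term g -> term (fun e => f e + g e)
  | term_sub f g : term f -> term g -> term (fun e => f e - g e)
  | term_mul f g : term f -> term g -> term (fun e => f e * g e)
  | term_div f g : term f -> term g -> term (fun e => f e %/ g e)
  | term_exp2 f : term f -> term (fun e => 2 ^ f e).

Lemma eq_term f g : term f -> f =1 g -> term g.
Proof. by move=> tf /funext <-. Qed.

Lemma term_aterm k f : term f ->
  exists t : aterm k, forall v : k.-tuple nat, aeval v t = f (nth 0 v).
Proof.
elim=> {f} [n|i|f g _ [s Hs] _ [t Ht]|f g _ [s Hs] _ [t Ht]
           |f g _ [s Hs] _ [t Ht]|f g _ [s Hs] _ [t Ht]|f _ [s Hs]].
- by exists (AConst _ n).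
- have [lti|lei] := ltnP i k.
    by exists (AVar (Ordinal lti)) => v /=; rewrite (tnth_nth 0).
  by exists (AConst _ 0) => v /=; rewrite nth_default ?size_tuple.
- by exists (AAdd s t) => v /=; rewrite Hs Ht.
- by exists (ASub s t) => v /=; rewrite Hs Ht.
- by exists (AMul s t) => v /=; rewrite Hs Ht.
- by exists (ADiv s t) => v /=; rewrite Hs Ht.
- by exists (APow (AConst _ 2) s) => v /=; rewrite Hs.
Qed.

Lemma term_subst f (s : env -> env) :
  term f -> (forall i, term (fun e => s e i)) -> term (fun e => f (s e)).
Proof.
move=> tf ts; elim: tf => {f} [n|i|f g _ Hf _ Hg|f g _ Hf _ Hg|f g _ Hf _ Hg
  |f g _ Hf _ Hg|f _ Hf] //.
- exact: term_const.
- exact: term_add.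
- exact: term_sub.
- exact: term_mul.
- exact: term_div.
- exact: term_exp2.
Qed.

Lemma term_mod f g : term f -> term g -> term (fun e => f e %% g e).
Proof.
move=> tf tg.
apply: (eq_term (term_sub tf (term_mul (term_div tf tg) tg))) => e /=.
by rewrite {1}(divn_eq (f e) (g e)) addKn.
Qed.

(** Modulo [2 ^ K - a] one has [2 ^ K = a], hence [2 ^ (K * b) = a ^ b]; [K] is large enough for
    [a ^ b] to be below the modulus. *)
Lemma expn_as_mod a b (K := a * b + a + 1) :
  a ^ b = 2 ^ (K * b) %% (2 ^ K - a).
Proof.
have lt2 n : n < 2 ^ n by exact: ltn_expl.
have ltK : (a ^ b + a).+1 <= 2 ^ K.
  have le1 : a ^ b <= 2 ^ (a * b).
    case: (posnP b) => [->|b0]; first by rewrite muln0.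
    by rewrite expnM leq_exp2r // ltnW.
  apply: leq_trans (_ : 2 ^ (a * b + a) + 2 ^ (a * b + a) <= _); last first.
    by rewrite addnn -mul2n -expnS /K addn1.
  rewrite -addnS; apply: leq_add; first by apply: leq_trans le1 _; rewrite leq_pexp2l ?leq_addr.
  by apply: leq_trans (lt2 a) _; rewrite leq_pexp2l ?leq_addl.
have leK : a <= 2 ^ K by lia.
have E : 2 ^ K = a %[mod 2 ^ K - a] by rewrite -{1}(subnK leK) modnDl.
rewrite expnM -modnXm E modnXm modn_small //; lia.
Qed.

Lemma term_expn f g : term f -> term g -> term (fun e => f e ^ g e).
Proof.
move=> tf tg.
have tK : term (fun e => f e * g e + f e + 1).
  apply: term_add (term_const 1); apply: term_add => //; exact: term_mul.
have t := term_mod (term_exp2 (term_mul tK tg)) (term_sub (term_exp2 tK) tf).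
by apply: (eq_term t) => e; rewrite -expn_as_mod.
Qed.

Lemma term_sum_ord k (F : nat -> env -> nat) :
  (forall i, i < k -> term (F i)) -> term (fun e => \sum_(i < k) F i e).
Proof.
elim: k => [|k IHk] tF.
  by apply: (eq_term (term_const 0)) => e; rewrite big_ord0.
apply: (eq_term (term_add (IHk _) (tF k (ltnSn k)))) => [i lti|e].
  by apply: tF; rewrite ltnS ltnW.
by rewrite big_ord_recr.
Qed.

(** The differences [(i+1)^a q^(i+1) - i^a q^i] telescope to [M^a q^M - 0^a]. Expanding [(i+1)^a]
    leaves [q - 1] times the sum sought plus [q] times sums with exponents [j < a]. *)
Lemma power_sum_recursion a M q : 1 < q ->
  \sum_(i < M) i ^ a * q ^ i =
  (M ^ a * q ^ M - ((a == 0) + q * \sum_(j < a) 'C(a, j) * \sum_(i < M) i ^ j * q ^ i))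
    %/ (q - 1).
Proof.
move=> q1; set S := \sum_(i < M) _; set T := \sum_(j < a) _.
suff E : M ^ a * q ^ M = (a == 0) + q * T + S * (q - 1).
  by rewrite E addKn mulnK // subn_gt0.
have -> : T = \sum_(i < M) (\sum_(j < a) 'C(a, j) * i ^ j) * q ^ i.
  under [RHS]eq_bigr do rewrite big_distrl.
  rewrite exchange_big; apply: eq_bigr => j _; rewrite big_distrr.
  by apply: eq_bigr => i _; rewrite /= mulnA.
rewrite {}/S {T}; elim: M => [|M IH].
  by rewrite !big_ord0 muln0 mul0n !addn0 expn0 muln1; case: a => [|a]; rewrite ?expn0 ?exp0n.
rewrite !big_ord_recr /=.
have -> : M.+1 ^ a = \sum_(j < a) 'C(a, j) * M ^ j + M ^ a.
  rewrite -[M.+1]add1n expnDn big_ord_recr /= binn mul1n subnn mul1n.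
  by congr (_ + _); apply: eq_bigr => j _; rewrite exp1n mul1n.
have -> : (q - 1) = q.-1 by rewrite subn1.
move: IH; rewrite subn1; case: q q1 => // q _ IH.
rewrite [in LHS]expnS; move: IH; rewrite /=.
move: (M ^ a) (q.+1 ^ M) (\sum_(_ < _) _) (\sum_(_ < _) _) (\sum_(_ < _) _).
move=> A B U T S IH.
transitivity (A * B + q * (A * B) + q.+1 * (U * B)); first by ring.
by rewrite {1}IH; ring.
Qed.

Lemma term_power_sum a M Q : term M -> term Q -> (forall e, 1 < Q e) ->
  term (fun e => \sum_(i < M e) i ^ a * Q e ^ i).
Proof.
move=> tM tQ Q1; have [n] := ubnP a; elim: n a => // n IHn a; rewrite ltnS => lean.
apply: (@eq_term (fun e => (M e ^ a * Q e ^ M e - ((a == 0) + Q e *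
   \sum_(j < a) 'C(a, j) * \sum_(i < M e) i ^ j * Q e ^ i)) %/ (Q e - 1))); last first.
  by move=> e; rewrite -power_sum_recursion.
apply: term_div; last by apply: term_sub => //; exact: term_const.
apply: term_sub.
  by apply: term_mul; apply: term_expn => //; exact: term_const.
apply: term_add; first exact: term_const.
apply: term_mul => //.
apply: (term_sum_ord (F := fun j e => 'C(a, j) * \sum_(i < M e) i ^ j * Q e ^ i)) => j ltj.
apply: term_mul; first exact: term_const.
exact: IHn (leq_trans ltj lean).
Qed.

Lemma term_geometric_sum M Q : term M -> term Q -> (forall e, 1 < Q e) ->
  term (fun e => \sum_(i < M e) Q e ^ i).
Proof.
move=> tM tQ Q1; apply: (eq_term (term_power_sum 0 tM tQ Q1)) => e.
by apply: eq_bigr => i _; rewrite mul1n.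
Qed.

(** In base [X] the collected coefficients are the digits: their total is below [X], so no carry
    occurs. *)
Lemma coefficient_extraction (T : finType) (c p : T -> nat) X n :
  \sum_t c t < X ->
  (\sum_t c t * X ^ p t) %/ X ^ n %% X = \sum_(t | p t == n) c t.
Proof.
move=> ltX; have X0 : 0 < X by apply: leq_ltn_trans ltX.
rewrite (bigID (fun t => p t < n)) /=.
set low := \sum_(t | p t < n) _.
rewrite (bigID (fun t => p t == n)) /=.
have -> : \sum_(t | ~~ (p t < n) && (p t == n)) c t * X ^ p t =
          (\sum_(t | p t == n) c t) * X ^ n.
  rewrite big_distrl; apply: eq_big => t.
    by case: (p t =P n) => [->|_]; rewrite ?ltnn ?andbF.
  by case/andP=> _ /eqP->.
have -> : \sum_(t | ~~ (p t < n) && (p t != n)) c t * X ^ p t =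
   (\sum_(t | ~~ (p t < n) && (p t != n)) c t * X ^ (p t - n.+1)) * X * X ^ n.
  rewrite -mulnA -expnS big_distrl; apply: eq_bigr => t /andP[H1 H2].
  by rewrite /= -mulnA -expnD subnK //; lia.
have ltl : low < X ^ n.
  case: n @low => [|n] /=.
    by rewrite big_pred0 // expn0.
  apply: (@leq_ltn_trans (\sum_t c t * X ^ n)).
    rewrite [leqRHS](bigID (fun t => p t < n.+1)) /=.
    apply: leq_trans (leq_addr _ _); apply: leq_sum => t Ht.
    by rewrite leq_mul2l leq_pexp2l ?orbT.
  by rewrite -big_distrl expnS ltn_pmul2r // expn_gt0 X0.
have leX : \sum_(t | p t == n) c t < X.
  apply: leq_ltn_trans ltX; rewrite [leqRHS](bigID (fun t => p t == n)) /=.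
  exact: leq_addr.
rewrite -mulnDl addnC divnMDl ?expn_gt0 ?X0 // divn_small // addn0.
by rewrite addnC modnMDl modn_small.
Qed.

(** * Binary digit sums *)

Lemma card_dvdn_ord d q : 0 < d -> \sum_(i < q * d) (d %| i) = q.
Proof.
move=> d0; elim: q => [|q IHq]; first by rewrite big_ord0.
rewrite mulSnr big_split_ord /= IHq -[RHS]addn1; congr (_ + _).
rewrite (bigD1 (Ordinal d0)) //= addn0 dvdn_mull // big1 // => i ne0.
rewrite dvdn_addr ?dvdn_mull // gtnNdvd //.
by rewrite lt0n; apply: contra ne0 => /eqP i0; apply/eqP/val_inj.
Qed.

(* The coefficient of X^(ab) counts the solutions of a i + b j = a b with i < b. *)
Lemma gcdn_as_coefficient a b (X := 2 ^ (b * a.+1)) : 0 < a -> 0 < b ->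
  gcdn a b = (\sum_(i < b) (X ^ a) ^ i) * (\sum_(j < a.+1) (X ^ b) ^ j)
     %/ X ^ (a * b) %% X.
Proof.
move=> a0 b0; have ltX : b * a.+1 < X by exact: ltn_expl.
clearbody X; rewrite big_distrlr /= pair_bigA /=.
under eq_bigr => t _ do rewrite -!expnM -expnD -[X ^ _]mul1n.
rewrite (@coefficient_extraction _ (fun=> 1) (fun t : 'I_b * 'I_a.+1 => a * t.1 + b * t.2)).
  rewrite -(pair_big_dep xpredT
    (fun (i : 'I_b) (j : 'I_a.+1) => a * i + b * j == a * b) (fun _ _ => 1)) /=.
  have g0 : 0 < gcdn a b by rewrite gcdn_gt0 a0.
  (* The admissible [i] are the multiples of [b %/ gcdn a b] below [b]. *)
  have {1}-> : gcdn a b = \sum_(i < b) (b %/ gcdn a b %| i).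
    have E : gcdn a b * (b %/ gcdn a b) = b by rewrite mulnC divnK ?dvdn_gcdr.
    have d0 : 0 < b %/ gcdn a b by rewrite divn_gt0 // dvdn_leq ?dvdn_gcdr.
    by have := card_dvdn_ord (gcdn a b) d0; rewrite E.
  apply: eq_bigr => i _.
  have -> (k : nat) : (b %/ gcdn a b %| k) = (b %| a * k).
    have Ea := divnK (dvdn_gcdl a b); have Eb := divnK (dvdn_gcdr a b).
    have cop : coprime (b %/ gcdn a b) (a %/ gcdn a b).
      by rewrite /coprime -(eqn_pmul2r g0) mul1n muln_gcdl Ea Eb gcdnC.
    by rewrite -[in RHS]Eb -[in X in _ %| X * _]Ea mulnAC dvdn_pmul2r // Gauss_dvdr.
  have lei : a * i <= a * b by rewrite leq_mul2l ltnW ?orbT.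
  case: dvdnP => [[k Ek]|ndv] /=.
    have ltj : a - k < a.+1 by lia.
    rewrite (bigD1 (Ordinal ltj)) /=; last first.
      by rewrite mulnBr (mulnC b a) (mulnC b k) -Ek subnKC.
    rewrite big1 ?addn0 // => j /andP[/eqP E /eqP nej]; case: nej.
    apply: val_inj => /=; apply/eqP; rewrite -(eqn_add2l k) -(eqn_pmul2r b0).
    by rewrite !mulnDl -Ek (mulnC j) E mulnBl -Ek subnKC.
  rewrite big1 // => j /eqP E; case: ndv; exists (a - j).
  by rewrite mulnBl -E (mulnC b) addnK.
by rewrite sum1_card card_prod !card_ord.
Qed.

(** The exponent [m] exceeds the valuation of [m], so the gcd catches the whole power of 2. *)
Lemma gcdn_pow2 m : 0 < m -> gcdn m (2 ^ m) = 2 ^ logn 2 m.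
Proof.
move=> m0; have [k co2 Em] := pfactor_coprime (isT : prime 2) m0.
have ltv : logn 2 m < m.
  have k0 : 0 < k by case: k co2 Em => // _; lia.
  by apply: leq_trans (ltn_expl _ (isT : 1 < 2)) _; rewrite [leqRHS]Em leq_pmull.
rewrite -{2}(subnK (ltnW ltv)) expnD {1}Em -muln_gcdl.
by rewrite (eqP (_ : coprime k _)) ?mul1n // coprime_sym coprimeXl.
Qed.

Lemma term_gcd f g : term f -> term g -> (forall e, 0 < f e) -> (forall e, 0 < g e) ->
  term (fun e => gcdn (f e) (g e)).
Proof.
move=> tf tg f0 g0.
have tS : term (fun e => (f e).+1).
  by apply: (eq_term (term_add tf (term_const 1))) => e; rewrite addn1.
have tX : term (fun e => 2 ^ (g e * (f e).+1)) by apply/term_exp2/term_mul.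
apply: (eq_term _ (fun e => esym (gcdn_as_coefficient (f0 e) (g0 e)))).
have X1 e k : 0 < k -> 1 < (2 ^ (g e * (f e).+1)) ^ k.
  by move=> k0; rewrite -expnM -{1}(expn0 2) ltn_exp2l // !muln_gt0 g0.
apply: term_mod => //; apply: term_div; last by apply: term_expn => //; exact: term_mul.
by apply: term_mul; apply: term_geometric_sum => //; try exact: term_expn; move=> e; exact: X1.
Qed.

(** Recovers an exponent from a power of 2: [(2 ^ v) ^ K] is [q ^ v], and [(q ^ v - 1) / (q - 1) = 1
    + q + ... + q ^ (v - 1)] is congruent to [v] modulo [q - 1]. *)
Lemma log2_as_digit_sum v K (q := 2 ^ K) : v.+1 < q ->
  v = ((2 ^ v) ^ K - 1) %/ (q - 1) %% (q - 1).
Proof.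
move=> ltv.
rewrite -expnM mulnC expnM -/q; clearbody q.
case: q ltv => [//|q] ltv; rewrite !subn1 predn_exp mulKn; last by lia.
have q1 : q.+1 = 1 %[mod q] by rewrite -add1n modnDr.
have -> : \sum_(i < v) q.+1 ^ i = v %[mod q].
  elim: v {ltv} => [|v IH]; first by rewrite big_ord0.
  by rewrite big_ord_recr /= -modnDm IH -(modnXm v q q.+1) q1 modnXm exp1n modnDm addn1.
by rewrite /= modn_small.
Qed.

(* The number of ones in the binary expansion of n (Kummer). *)
Definition weight n := logn 2 'C(n.*2, n).

Lemma logn2_odd n : logn 2 n.*2.+1 = 0.
Proof. by rewrite logn_coprime // coprime2n /= odd_double. Qed.

Lemma logn2_double_fact n : logn 2 (n.*2)`! = n + logn 2 n`!.
Proof.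
elim: n => // n IHn.
rewrite doubleS !factS !lognM ?muln_gt0 ?fact_gt0 // IHn.
rewrite -doubleS -muln2 lognM // logn2_odd.
by have -> : logn 2 2 = 1 by []; lia.
Qed.

(** Legendre's formula for the prime 2. *)
Lemma weightD_logn_fact n : weight n + logn 2 n`! = n.
Proof.
have le : n <= n.*2 by lia.
have := congr1 (logn 2) (bin_fact le); rewrite -{2}addnn addnK.
rewrite !lognM ?muln_gt0 ?fact_gt0 ?bin_gt0 // logn2_double_fact -/(weight n).
lia.
Qed.

(** This recursion identifies [weight] with the binary digit sum. *)
Lemma weight_bit (b : bool) n : weight (b + n.*2) = b + weight n.
Proof.
have := weightD_logn_fact (b + n.*2); have := weightD_logn_fact n.
case: b => /=; rewrite ?add0n; last by rewrite logn2_double_fact; lia.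
rewrite add1n factS lognM ?fact_gt0 // logn2_double_fact logn2_odd.
lia.
Qed.

Lemma weightMDl k a b : b < 2 ^ k -> weight (2 ^ k * a + b) = weight a + weight b.
Proof.
elim: k b => [|k IHk] b; first by rewrite ltnS leqn0 => /eqP->; rewrite mul1n addn0 addn0.
rewrite expnS => ltb; rewrite -[in LHS](odd_double_half b) -[in RHS](odd_double_half b).
have -> : 2 * 2 ^ k * a + (odd b + b./2.*2) = odd b + (2 ^ k * a + b./2).*2 by lia.
by rewrite !weight_bit IHk; lia.
Qed.

Lemma weight_compl L m : m < 2 ^ L -> weight m + weight (2 ^ L - 1 - m) = L.
Proof.
elim: L m => [|L IHL] m.
  rewrite ltnS leqn0 => /eqP->; exact: erefl.
rewrite expnS => ltm; rewrite -(odd_double_half m).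
have -> : 2 * 2 ^ L - 1 - (odd m + m./2.*2) = ~~ odd m + (2 ^ L - 1 - m./2).*2.
  by move: (odd m) (odd_double_half m) => []; lia.
rewrite !weight_bit -[in RHS](IHL m./2); last by lia.
by case: (odd m) => /=; lia.
Qed.

(* For 0 < E the product is 2^L (E - 1) + (2^L - E), whose two halves are complementary. *)
Lemma weight_nonzero_test L E : E <= 2 ^ L -> weight ((2 ^ L - 1) * E) = (E != 0) * L.
Proof.
case: E => [|E] leE; first by rewrite muln0.
have -> : (2 ^ L - 1) * E.+1 = 2 ^ L * E + (2 ^ L - 1 - E).
  move: (2 ^ L) leE => [//|P] leE.
  by rewrite subn1 /= mulnS mulSn; lia.
by rewrite weightMDl ?weight_compl ?mul1n //; lia.
Qed.

(** The base exceeds [2 ^ n.*2], the sum of all coefficients of the binomial expansion. *)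
Lemma central_bin_as_coefficient n (X := 2 ^ n.*2.+1) :
  'C(n.*2, n) = (1 + X) ^ n.*2 %/ X ^ n %% X.
Proof.
rewrite expnDn; under eq_bigr do rewrite exp1n mul1n.
rewrite (@coefficient_extraction _ (fun i : 'I__ => 'C(n.*2, i)) (fun i : 'I__ => i)).
  have ltn : n < n.*2.+1 by lia.
  by rewrite (big_pred1 (Ordinal ltn)).
suff -> : \sum_(i < n.*2.+1) 'C(n.*2, i) = 2 ^ n.*2 by rewrite ltn_exp2l.
by rewrite (expnDn 1 1); apply: eq_bigr => i _; rewrite !exp1n !muln1.
Qed.

Lemma term_weight f : term f -> term (fun e => weight (f e)).
Proof.
move=> tf; have t2 : term (fun e => (f e).*2).
  by apply: (eq_term (term_add tf tf)) => e; rewrite addnn.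
have tX : term (fun e => 2 ^ (f e).*2.+1).
  by apply/term_exp2/(eq_term (term_add t2 (term_const 1))) => e; rewrite addn1.
have tC : term (fun e => 'C((f e).*2, f e)).
  apply: (eq_term _ (fun e => esym (central_bin_as_coefficient (f e)))).
  apply: term_mod => //; apply: term_div; apply: term_expn => //.
  by apply: term_add => //; exact: term_const.
have C0 e : 0 < 'C((f e).*2, f e) by rewrite bin_gt0; lia.
have tP : term (fun e => 2 ^ weight (f e)).
  apply: (eq_term (term_gcd tC (term_exp2 tC) C0 _)) => [e|e]; first by rewrite expn_gt0.
  by rewrite gcdn_pow2.
(* This is the [K] of [log2_as_digit_sum]: as [weight n <= n], it satisfies
   [weight n + 1 < 2 ^ (n + 1)]. *)
have tK : term (fun e => (f e).+1).
  by apply: (eq_term (term_add tf (term_const 1))) => e; rewrite addn1.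
have tq : term (fun e => 2 ^ (f e).+1 - 1).
  by apply: term_sub (term_const 1); exact: term_exp2.
apply: (eq_term (term_mod (term_div (term_sub (term_expn tP tK) (term_const 1)) tq) tq)).
move=> e /=; rewrite -log2_as_digit_sum //.
apply: leq_ltn_trans (ltn_expl _ (isT : 1 < 2)).
by have := weightD_logn_fact (f e); lia.
Qed.

(** * Counting zeros of exponential polynomials in a cube *)

Definition scons (x : nat) (e : env) : env := fun n => if n is n'.+1 then e n' else x.

(* p carries the parameters, on which coefficients depend through arbitrary terms, and
   e the unknowns, which only occur polynomially and as exponents of 2. *)
Inductive exppoly : (env -> env -> nat) -> Prop :=
  | exppoly_coef f : term f -> exppoly (fun p _ => f p)
  | exppoly_var i : exppoly (fun _ e => e i)
  | exppoly_exp2 i : exppoly (fun _ e => 2 ^ e i)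
  | exppoly_add F G : exppoly F -> exppoly G -> exppoly (fun p e => F p e + G p e)
  | exppoly_mul F G : exppoly F -> exppoly G -> exppoly (fun p e => F p e * G p e).

Lemma eq_exppoly F G : exppoly F -> F =2 G -> exppoly G.
Proof. by move=> eF FG; rewrite -(_ : F = G) //; apply/funext => p; apply/funext. Qed.

Lemma exppoly_term F : exppoly F -> term (fun e => F e e).
Proof.
elim=> {F} [f tf|i|i|F G _ IF _ IG|F G _ IF _ IG] //.
- exact: term_var.
- exact/term_exp2/term_var.
- exact: term_add.
- exact: term_mul.
Qed.

(** Isolates the unknown [i] to be summed next: it occurs in factors [i ^ a * 2 ^ (k * i)] with
    fixed [a] and [k], whose coefficients involve only the other unknowns. *)
Inductive headpoly : (env -> nat -> env -> nat) -> Prop :=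
  | headpoly_monomial G a k : exppoly G ->
      headpoly (fun p i e => G p e * (i ^ a * (2 ^ k) ^ i))
  | headpoly_add H K : headpoly H -> headpoly K ->
      headpoly (fun p i e => H p i e + K p i e).

Lemma eq_headpoly H K : headpoly H -> (forall p i e, H p i e = K p i e) -> headpoly K.
Proof.
move=> hH HK; rewrite -(_ : H = K) //.
by apply/funext => p; apply/funext => i; apply/funext.
Qed.

Lemma headpoly_mul H K : headpoly H -> headpoly K ->
  headpoly (fun p i e => H p i e * K p i e).
Proof.
move=> hH hK; elim: hH => {H} [G a k eG|H H' _ IH _ IH']; last first.
  by apply: (eq_headpoly (headpoly_add IH IH')) => p i e; rewrite mulnDl.
elim: hK => {K} [G' a' k' eG'|K K' _ IK _ IK']; last first.
  by apply: (eq_headpoly (headpoly_add IK IK')) => p i e; rewrite mulnDr.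
apply: (eq_headpoly (headpoly_monomial (a + a') (k + k') (exppoly_mul eG eG'))).
by move=> p i e; rewrite !expnD expnMn; ring.
Qed.

Lemma exppoly_headpoly F : exppoly F -> headpoly (fun p i e => F p (scons i e)).
Proof.
have coef G : exppoly G -> headpoly (fun p _ e => G p e).
  move=> eG; apply: (eq_headpoly (headpoly_monomial 0 0 eG)) => p i e.
  by rewrite !expn0 exp1n !muln1.
have e1 : exppoly (fun _ _ => 1) by exact: exppoly_coef (term_const 1).
elim=> {F} [f tf|[|i]|[|i]|F G _ IF _ IG|F G _ IF _ IG].
- exact/coef/exppoly_coef.
- apply: (eq_headpoly (headpoly_monomial 1 0 e1)) => p i e.
  by rewrite /= expn0 exp1n mul1n muln1.
- exact/coef/exppoly_var.
- apply: (eq_headpoly (headpoly_monomial 0 1 e1)) => p i e.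
  by rewrite /= expn0 !mul1n.
- exact/coef/exppoly_exp2.
- exact: headpoly_add.
- exact: headpoly_mul.
Qed.

(** The coefficients leave the sum, and a power sum of ratio [Q p * 2 ^ k] remains, a term in the
    parameters alone. This eliminates one unknown. *)
Lemma headpoly_weighted_sum H M Q :
  headpoly H -> term M -> term Q -> (forall p, 1 < Q p) ->
  exppoly (fun p e => \sum_(i < M p) Q p ^ i * H p i e).
Proof.
move=> hH tM tQ Q1; elim: hH => {H} [G a k eG|H K _ IH _ IK]; last first.
  apply: (eq_exppoly (exppoly_add IH IK)) => p e; rewrite -big_split.
  by apply: eq_bigr => i _; rewrite mulnDr.
have tS : term (fun p => \sum_(i < M p) i ^ a * (Q p * 2 ^ k) ^ i).
  apply: term_power_sum => // [|p].
    exact/(term_mul tQ)/term_exp2/term_const.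
  by rewrite (leq_trans (Q1 p)) // leq_pmulr // expn_gt0.
apply: (eq_exppoly (exppoly_mul eG (exppoly_coef tS))) => p e.
by rewrite big_distrr; apply: eq_bigr => i _ /=; rewrite expnMn; ring.
Qed.

(** Each point of the cube is weighted by [X] to its position, the coordinates being digits in base
    [M], the outermost most significant. *)
Fixpoint weighted_sum m M X (F : env -> nat) (e : env) : nat :=
  if m is m'.+1
  then \sum_(i < M) (X ^ M ^ m') ^ i * weighted_sum m' M X F (scons i e)
  else F e.

Fixpoint count_zeros m M (F : env -> nat) (e : env) : nat :=
  if m is m'.+1 then \sum_(i < M) count_zeros m' M F (scons i e) else F e == 0.

Lemma exppoly_weighted_sums m F M X :
  exppoly F -> term M -> term X -> (forall p, 0 < M p) -> (forall p, 1 < X p) ->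
  exppoly (fun p e => weighted_sum m (M p) (X p) (F p) e).
Proof.
move=> eF tM tX M0 X1; elim: m => [|m IHm] //=.
apply: (headpoly_weighted_sum (exppoly_headpoly IHm) tM) => [|p].
  by do 2![apply: term_expn => //]; exact: term_const.
rewrite -(exp1n (M p ^ m)) ltn_exp2r //.
by rewrite expn_gt0 M0.
Qed.

Lemma weighted_sumD m M X F G e :
  weighted_sum m M X (fun e => F e + G e) e =
  weighted_sum m M X F e + weighted_sum m M X G e.
Proof.
elim: m e => //= m IHm e; rewrite -big_split.
by apply: eq_bigr => i _; rewrite IHm mulnDr.
Qed.

Lemma weighted_sumZ m M X c F e :
  weighted_sum m M X (fun e => c * F e) e = c * weighted_sum m M X F e.
Proof.
elim: m e => //= m IHm e; rewrite big_distrr.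
by apply: eq_bigr => i _ /=; rewrite IHm mulnCA.
Qed.

Definition mono (f : env -> nat) :=
  forall e e', (forall i, e i <= e' i) -> f e <= f e'.

Lemma exppoly_mono F : exppoly F -> forall p, mono (F p).
Proof.
elim=> {F} [f _|i|i|F G _ IF _ IG|F G _ IF _ IG] p e e' le /=.
- by [].
- exact: le.
- by rewrite leq_pexp2l.
- by rewrite leq_add ?IF ?IG.
- by rewrite leq_mul ?IF ?IG.
Qed.

Lemma weight_blocks k M N : (forall i, i < M -> N i < 2 ^ k) ->
  \sum_(i < M) (2 ^ k) ^ i * N i < (2 ^ k) ^ M /\
  weight (\sum_(i < M) (2 ^ k) ^ i * N i) = \sum_(i < M) weight (N i).
Proof.
elim: M => [|M IHM] ltN; first by rewrite !big_ord0.
have [i ltiM|ltS wS] := IHM; first by apply: ltN; exact: ltnW.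
rewrite !big_ord_recr /= addnC; split; last first.
  by rewrite -expnM weightMDl ?expnM // wS addnC.
rewrite expnSr (leq_trans (_ : _ < (2 ^ k) ^ M * (N M).+1)) //.
  by rewrite mulnS addnC ltn_add2r.
by rewrite leq_mul2l ltN ?orbT.
Qed.

(** Each point occupies its own block of [L.*2] bits. As [A] is monotone, its value at the far
    corner [iter m (scons M) e] bounds [E] on the whole cube, so [weight_nonzero_test] applies to
    every block. *)
Lemma count_zeros_weight L m M E A e :
  mono A -> (forall e, E e <= A e) -> A (iter m (scons M) e) <= 2 ^ L ->
  let S := weighted_sum m M (2 ^ L.*2) (fun e => (2 ^ L - 1) * E e) e in
  S < (2 ^ L.*2) ^ M ^ m /\ weight S + L * count_zeros m M E e = L * M ^ m.
Proof.
move=> monoA leEA; elim: m e => [|m IHm] e leA /=.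
  have leE : E e <= 2 ^ L by exact: leq_trans (leEA e) leA.
  rewrite weight_nonzero_test // -addnn expnD expn0 expn1; split.
    have : 0 < 2 ^ L by rewrite expn_gt0.
    move: (2 ^ L) leE => [//|P] leE _; rewrite subn1 /= mulSn.
    by apply: leq_ltn_trans (leq_mul (leqnn P) leE) _; rewrite -[X in X < _]add0n ltn_add2r.
  by case: (E e) => [|n]; rewrite ?muln0 ?mul1n ?muln1 ?addn0.
have mono_iter k e1 e2 : (forall i, e1 i <= e2 i) ->
    forall i, iter k (scons M) e1 i <= iter k (scons M) e2 i.
  by move=> le12; elim: k => //= k IHk [|i] /=.
set N := fun i => weighted_sum m M (2 ^ L.*2) (fun e => (2 ^ L - 1) * E e) (scons i e).
have IH i : i < M -> N i < 2 ^ (L.*2 * M ^ m) /\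
    weight (N i) + L * count_zeros m M E (scons i e) = L * M ^ m.
  move=> lti; rewrite expnM; apply: IHm; apply: leq_trans leA.
  rewrite iterSr; apply/monoA/mono_iter => -[|j] //=; exact: ltnW.
have [i /IH[]//|lt w] := @weight_blocks (L.*2 * M ^ m) M N.
rewrite expnM in lt w; split; first by rewrite expnSr expnM; exact: lt.
rewrite [X in X + _]w big_distrr -big_split /= (eq_bigr (fun=> L * M ^ m)) => [|i _].
  by rewrite sum_nat_const card_ord expnS mulnCA.
by have [] := IH _ (ltn_ord i).
Qed.

(** Weighted sums are additive, so that of [E] is obtained by subtracting that of [B] from that of
    [A], both in closed form. *)
Lemma term_count_zeros m A B E M :
  exppoly (fun=> A) -> exppoly (fun=> B) -> (forall e, A e = B e + E e) ->
  term M -> (forall e, 0 < M e) -> term (fun e => count_zeros m (M e) E e).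
Proof.
move=> eA eB AE tM M0.
have tA : term A := exppoly_term eA.
have monoA : mono A := exppoly_mono eA id.
have leEA e : E e <= A e by rewrite AE leq_addl.
(* The value at the corner is at most [2 ^ L], and the successor keeps [L] positive for the
   division. *)
pose L e := (A (iter m (scons (M e)) e)).+1.
have tL : term L.
  have tI : term (fun e => A (iter m (scons (M e)) e)).
    apply: (term_subst (s := fun e => iter m (scons (M e)) e)) => //.
    elim: m {L} => [|m IHm] i /=; first exact: term_var.
    by case: i => [|i] //=.
  by apply: (eq_term (term_add tI (term_const 1))) => e; rewrite addn1.
pose X e := 2 ^ (L e).*2.
have tX : term X.
  by apply/term_exp2/(eq_term (term_add tL tL)) => e; rewrite addnn.
have X1 e : 1 < X e by rewrite /X /L doubleS -{1}(expn0 2) ltn_exp2l.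
have tW F : exppoly (fun=> F) -> term (fun e => weighted_sum m (M e) (X e) F e).
  move=> eF; exact: (exppoly_term (exppoly_weighted_sums m eF tM tX M0 X1)).
have tp2 : term (fun e => 2 ^ L e - 1).
  by apply: term_sub (term_const 1); exact: term_exp2.
have tMm : term (fun e => M e ^ m) by apply: term_expn => //; exact: term_const.
have t := term_sub tMm (term_div (term_weight (term_mul tp2 (term_sub (tW A eA) (tW B eB)))) tL).
apply: (eq_term t) => e /=.
have leL : A (iter m (scons (M e)) e) <= 2 ^ L e by rewrite ltnW // ltnW // ltn_expl.
have [_] := count_zeros_weight monoA leEA leL; rewrite weighted_sumZ -/(X e).
have -> : weighted_sum m (M e) (X e) A e =
    weighted_sum m (M e) (X e) B e + weighted_sum m (M e) (X e) E e.
  by rewrite -weighted_sumD; congr weighted_sum; apply/funext.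
rewrite addKn => W.
have cntle : count_zeros m (M e) E e <= M e ^ m.
  by rewrite -(leq_pmul2l (ltn0Sn _ : 0 < L e)) -W leq_addl.
have -> : weight ((2 ^ L e - 1) * weighted_sum m (M e) (X e) E e) =
    L e * (M e ^ m - count_zeros m (M e) E e) by rewrite mulnBr -W addnK.
by rewrite mulKn // subKn.
Qed.

(** * Terms as numbers of zeros *)

Definition scat (s : seq nat) (e : env) : env := foldr scons e s.
Definition sdrop n (e : env) : env := fun i => e (n + i).

Lemma scat_rcons s x e : scat (rcons s x) e = scat s (scons x e).
Proof. by rewrite /scat foldr_rcons. Qed.

Lemma scatE s e i : scat s e i = if i < size s then nth 0 s i else e (i - size s).
Proof. by elim: s i => [|x s IHs] [|i] //=; rewrite ?subn0 ?IHs. Qed.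

Lemma mono_scat s s' e e' : size s = size s' ->
  (forall i, nth 0 s i <= nth 0 s' i) -> (forall i, e i <= e' i) ->
  forall i, scat s e i <= scat s' e' i.
Proof. by move=> Es les lee i; rewrite !scatE Es; case: ifP. Qed.

Lemma exppoly_rename F r : exppoly F -> exppoly (fun p e => F p (e \o r)).
Proof.
elim=> {F} [f tf|i|i|F G _ IF _ IG|F G _ IF _ IG].
- exact: exppoly_coef.
- exact: exppoly_var.
- exact: exppoly_exp2.
- exact: exppoly_add.
- exact: exppoly_mul.
Qed.

Definition exppoly_diff (E : env -> nat) := exists A B,
  [/\ exppoly (fun=> A), exppoly (fun=> B) & forall e, A e = B e + E e].

Lemma exppoly_diffD E E' : exppoly_diff E -> exppoly_diff E' ->
  exppoly_diff (fun e => E e + E' e).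
Proof.
move=> [A [B [eA eB AB]]] [A' [B' [eA' eB' AB']]].
exists (fun e => A e + A' e), (fun e => B e + B' e).
by split=> [||e]; [exact: exppoly_add|exact: exppoly_add|rewrite AB AB' addnACA].
Qed.

Lemma exppoly_diff_rename E r : exppoly_diff E -> exppoly_diff (fun e => E (e \o r)).
Proof.
move=> [A [B [eA eB AB]]]; exists (fun e => A (e \o r)), (fun e => B (e \o r)).
by split=> [||e]; [exact: (exppoly_rename r eA)|exact: (exppoly_rename r eB)|].
Qed.

(** The square of [P - Q]. It encodes the equation [P = Q]; as values are natural numbers, a sum of
    such expressions encodes a conjunction. *)
Definition sqdist (P Q : env -> nat) (e : env) := P e ^ 2 + Q e ^ 2 - 2 * (P e * Q e).

Lemma sqdist_eq0 P Q e : (sqdist P Q e == 0) = (P e == Q e).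
Proof.
rewrite /sqdist subn_eq0; have [le1 <-] := nat_Cauchy (P e) (Q e).
by rewrite eqn_leq le1.
Qed.

Lemma exppoly_diff_sqdist P Q : exppoly (fun=> P) -> exppoly (fun=> Q) ->
  exppoly_diff (sqdist P Q).
Proof.
move=> eP eQ; exists (fun e => P e * P e + Q e * Q e), (fun e => 2 * (P e * Q e)).
split=> [||e].
- by apply: exppoly_add; exact: exppoly_mul.
- by apply: exppoly_mul; [exact: (exppoly_coef (term_const 2))|exact: exppoly_mul].
- by rewrite !mulnn subnKC // nat_Cauchy.
Qed.

(** The count is the same for all sides [M >= b e], so that the sides required by several systems
    can be combined; monotonicity lets unknowns be replaced by upper bounds inside [b]. *)
Definition zero_counting (K : env -> nat) := exists m E b,
  [/\ exppoly_diff E, term b, mono b &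
      forall e M, b e <= M -> K e = count_zeros m M E e].

Lemma zero_counting_term K : zero_counting K -> term K.
Proof.
move=> [m [E [b [[A [B [eA eB AB]]] tb _ KE]]]].
have tM : term (fun e => b e + 1) by exact: term_add (term_const 1).
apply: (eq_term (term_count_zeros m eA eB AB tM _)) => [e|e]; first by rewrite addn1.
by rewrite -KE // addn1.
Qed.

Definition rup (r : nat -> nat) n := if n is n'.+1 then (r n').+1 else 0.

Lemma scons_rup x e r : scons x e \o rup r = scons x (e \o r).
Proof. by apply/funext => -[|i]. Qed.

Lemma count_zeros_rename m M E r e :
  count_zeros m M (fun e => E (e \o iter m rup r)) e = count_zeros m M E (e \o r).
Proof.
elim: m r e => //= m IHm r e; apply: eq_bigr => i _.
have -> : rup (iter m rup r) = iter m rup (rup r) by rewrite -iterSr.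
by rewrite (IHm (rup r)) scons_rup.
Qed.

Lemma zero_counting_rename K r : zero_counting K -> zero_counting (fun e => K (e \o r)).
Proof.
move=> [m [E [b [eE tb mb KE]]]].
exists m, (fun e => E (e \o iter m rup r)), (fun e => b (e \o r)); split=> //.
- exact: exppoly_diff_rename.
- by apply: (term_subst (s := fun e => e \o r)) => // i; exact: term_var.
- by move=> e e' le; apply: mb => i; exact: le.
- by move=> e M leM; rewrite count_zeros_rename -KE.
Qed.

(** [G] reads only variables outside the cube, so its vanishing factors out of the count. *)
Lemma count_zerosDl m M E G e :
  count_zeros m M (fun e => E e + G (sdrop m e)) e = (G e == 0) * count_zeros m M E e.
Proof.
elim: m G e => [|m IHm] G e /=.
  by rewrite (_ : sdrop 0 e = e) // addn_eq0 mulnb andbC.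
rewrite big_distrr; apply: eq_bigr => i _ /=.
have dropS e' : sdrop m.+1 e' = sdrop 1 (sdrop m e').
  by apply/funext => j; rewrite /sdrop addnA addn1.
under [in LHS]eq_fun do rewrite dropS.
exact: IHm (fun e => G (sdrop 1 e)) (scons i e).
Qed.

Lemma count_zeros_unique k m M F e w c : size w = k -> all (ltn^~ M) w ->
  (forall s, size s = k -> count_zeros m M F (scat s e) = (s == w) * c) ->
  count_zeros (k + m) M F e = c.
Proof.
elim: k w e c => [|k IHk] w e c.
  by move=> /size0nil -> _ /(_ [::] erefl) /=; rewrite mul1n.
case/lastP: w => // w x; rewrite size_rcons all_rcons => -[sw] /andP[ltx allw] H.
rewrite addSn /= (bigD1 (Ordinal ltx)) //= [X in _ + X]big1 ?addn0 => [|i nei].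
  apply: (IHk w) => // s ss; rewrite -scat_rcons H ?size_rcons ?ss //.
  by rewrite eqseq_rcons eqxx andbT.
apply: (IHk w) => // s ss; rewrite -scat_rcons H ?size_rcons ?ss //.
rewrite eqseq_rcons (_ : (i == x :> nat) = false) ?andbF ?muln0 //.
by apply: contraNF nei => /eqP Ei; apply/eqP/val_inj.
Qed.

(* If the system G has exactly one solution w e over e, its unknowns can be added to those
   counted by K without changing the count. *)
Lemma zero_counting_witness k (w : env -> seq nat) G b0 K :
  exppoly_diff G -> (forall e, size (w e) = k) ->
  (forall e s, size s = k -> (G (scat s e) == 0) = (s == w e)) ->
  term b0 -> mono b0 -> (forall e, all (ltn^~ (b0 e)) (w e)) ->
  zero_counting K -> zero_counting (fun e => K (scat (w e) e)).
Proof.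
move=> eG sw Gw tb0 mb0 ltb0 [m [E [b [eE tb mb KE]]]].
(* In the bound, the new unknowns are replaced by their upper bound [b0 e]; the summand [b0 e] makes
   the cube contain [w e]. *)
exists (k + m), (fun e => E e + G (sdrop m e)),
  (fun e => b (scat (nseq k (b0 e)) e) + b0 e); split.
- exact/(exppoly_diffD eE)/(exppoly_diff_rename (addn m)).
- apply: term_add => //; apply: (term_subst (s := fun e => scat (nseq k (b0 e)) e)) => // i.
  have [ltik|leki] := ltnP i k.
    by apply: (eq_term tb0) => e; rewrite scatE size_nseq ltik nth_nseq ltik.
  apply: (eq_term (term_var (i - k))) => e.
  by rewrite scatE size_nseq ltnNge leki.
- move=> e e' le; apply: leq_add; last exact: mb0.
  apply/mb/mono_scat => //; first by rewrite !size_nseq.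
  by move=> i; rewrite !nth_nseq; case: ifP => // _; exact: mb0.
move=> e M leM; have leb0 : b0 e <= M by apply: leq_trans leM; rewrite leq_addl.
rewrite (@count_zeros_unique k m M _ e (w e) (K (scat (w e) e))) //.
  by apply: sub_all (ltb0 e) => i lti; exact: leq_trans lti leb0.
move=> s ss; rewrite count_zerosDl Gw //; have [->|//] := eqVneq s (w e).
rewrite -KE //; apply: leq_trans leM; apply: leq_trans (leq_addr _ _).
apply/mb/mono_scat => //; rewrite ?size_nseq //.
move=> i; rewrite nth_nseq; case: ltnP => [lti|lei]; last by rewrite nth_default ?sw.
by have /all_nthP-/(_ 0 i) := ltb0 e; rewrite sw => /(_ lti)/ltnW.
Qed.

Lemma zero_counting1 : zero_counting (fun=> 1).
Proof.
exists 0, (fun=> 0), (fun=> 0); split=> //; last exact: term_const.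
have e0 : exppoly (fun _ _ => 0) by exact: exppoly_coef (term_const 0).
by exists (fun=> 0), (fun=> 0); split.
Qed.

(** The index [i] becomes an unknown, with a slack [s] such that [s + i + 1 = e j]: it exists,
    uniquely, exactly when [i < e j]. Renaming by [succn] makes [K] skip the slack. *)
Lemma zero_counting_bounded_sum K j : zero_counting K ->
  zero_counting (fun e => \sum_(i < e j) K (scons i e)).
Proof.
move=> /(zero_counting_rename succn) [m [E [b [eE tb mb KE]]]].
pose G := sqdist (fun e => e 0 + e 1 + 1) (fun e => e j.+2).
exists m.+2, (fun e => E e + G (sdrop m e)), (fun e => b (scat [:: e j; e j] e) + e j).
split.
- apply: (exppoly_diffD eE); apply: (exppoly_diff_rename (addn m)).
  apply: exppoly_diff_sqdist; last exact: exppoly_var.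
  apply: exppoly_add; last exact: exppoly_coef (term_const 1).
  by apply: exppoly_add; exact: exppoly_var.
- apply: term_add; last exact: term_var.
  by apply: (term_subst (s := fun e => scat [:: e j; e j] e)) => // -[|[|i]];
    exact: term_var.
- by move=> e e' le; apply: leq_add => //; apply: mb => -[|[|i]] /=.
move=> e M leM; have leN : e j <= M by apply: leq_trans leM; exact: leq_addl.
rewrite (big_ord_widen _ (fun i => K (scons i e)) leN) big_mkcond /=.
apply: eq_bigr => i _.
under eq_bigr => s _ do rewrite count_zerosDl sqdist_eq0 /=.
have [lti|lei] := ltnP i (e j); last first.
  by rewrite big1 // => s _; rewrite (_ : (_ == _) = false) ?mul0n //; lia.
have lts : e j - i.+1 < M by lia.
rewrite (bigD1 (Ordinal lts)) //= (_ : (_ == _) = true) ?mul1n; last by lia.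
rewrite big1 ?addn0 => [|s nes]; last first.
  rewrite (_ : (_ == _) = false) ?mul0n //.
  by apply: contraNF nes => /eqP Es; apply/eqP/val_inj => /=; lia.
rewrite -KE //; apply: leq_trans leM; apply: leq_trans (leq_addr _ _).
by apply: mb => -[|[|k]] //=; lia.
Qed.

(** An arbitrary [K] reads the value of [f] as variable 0; in this form operations compose by
    pushing one value after another. *)
Definition zero_counting_op (f : env -> nat) := forall K,
  zero_counting K -> zero_counting (fun e => K (scons (f e) e)).

Lemma zero_counting_op_witness k (w : env -> seq nat) G b0 :
  exppoly_diff G -> (forall e, size (w e) = k.+1) ->
  (forall e s, size s = k.+1 -> (G (scat s e) == 0) = (s == w e)) ->
  term b0 -> mono b0 -> (forall e, all (ltn^~ (b0 e)) (w e)) ->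
  zero_counting_op (fun e => head 0 (w e)).
Proof.
move=> eG sw Gw tb mb ltb K cK.
have := zero_counting_witness eG sw Gw tb mb ltb
  (zero_counting_rename (fun i => if i is i'.+1 then k.+1 + i' else 0) cK).
congr zero_counting; apply/funext => e; congr K; apply/funext => -[|i] /=.
  by case: (w e) (sw e).
by rewrite scatE sw ltnNge leq_addr addKn.
Qed.

Lemma exppoly_diff_exppoly P : exppoly (fun=> P) -> exppoly_diff P.
Proof.
move=> eP; exists P, (fun=> 0); split=> //.
exact: (exppoly_coef (term_const 0)).
Qed.

Lemma zero_counting_op_exppoly P :
  exppoly (fun=> P) -> zero_counting_op P.
Proof.
move=> eP.
apply: (@zero_counting_op_witness 0 (fun e => [:: P e])
  (sqdist (fun e => e 0) (fun e => P (sdrop 1 e))) (fun e => P e + 1)) => //.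
- apply: exppoly_diff_sqdist; first exact: exppoly_var.
  exact: (exppoly_rename (addn 1) eP).
- move=> e [|y []] // _; rewrite sqdist_eq0 eqseq_cons andbT /=.
  by congr (_ == P _).
- by apply: term_add (term_const 1); exact: (exppoly_term eP).
- by move=> e e' le; rewrite leq_add2r; exact: (exppoly_mono eP e).
- by move=> e /=; rewrite addn1 ltnSn.
Qed.

(** The two truncated differences are the only solution of [y + e j = e i + s], [y * s = 0]. *)
Lemma zero_counting_op_sub i j : zero_counting_op (fun e => e i - e j).
Proof.
apply: (@zero_counting_op_witness 1 (fun e => [:: e i - e j; e j - e i])
  (fun e => sqdist (fun e => e 0 + e j.+2) (fun e => e i.+2 + e 1) e + e 0 * e 1)
  (fun e => e i + e j + 1)) => //.
- apply: exppoly_diffD.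
    by apply: exppoly_diff_sqdist; apply: exppoly_add; exact: exppoly_var.
  by apply: exppoly_diff_exppoly; apply: exppoly_mul; exact: exppoly_var.
- move=> e [|y [|s []]] // _; rewrite addn_eq0 sqdist_eq0 muln_eq0 !eqseq_cons andbT /=.
  by lia.
- apply: term_add (term_const 1); apply: term_add; exact: term_var.
- by move=> e e' le; rewrite leq_add2r leq_add.
- by move=> e /=; lia.
Qed.

(* Over a, b the system reads a = b y + r, r + 1 + s = b + x, x (s + b + y) = 0: for b > 0
   it forces x = 0, hence r < b, and for b = 0 it forces x = r + 1, hence y = 0. *)
Lemma zero_counting_op_div i j : zero_counting_op (fun e => e i %/ e j).
Proof.
pose w a b := [:: a %/ b; a %% b; b - (a %% b).+1; (a %% b).+1 - b].
apply: (@zero_counting_op_witness 3 (fun e => w (e i) (e j))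
  (fun e => sqdist (fun e => e i.+4) (fun e => e j.+4 * e 0 + e 1) e
    + sqdist (fun e => e 1 + 1 + e 2) (fun e => e j.+4 + e 3) e
    + e 3 * (e 2 + e j.+4 + e 0))
  (fun e => e i + e j + 2)) => //.
- have e1 : exppoly (fun _ _ => 1) by exact: exppoly_coef (term_const 1).
  do ![apply: exppoly_diffD].
  + apply: exppoly_diff_sqdist; first exact: exppoly_var.
    by do ?[apply: exppoly_add|apply: exppoly_mul]; exact: exppoly_var.
  + by apply: exppoly_diff_sqdist; do ?apply: exppoly_add => //; exact: exppoly_var.
  + apply: exppoly_diff_exppoly.
    by apply: exppoly_mul; do ?apply: exppoly_add; exact: exppoly_var.
- move=> e [|y [|r [|s [|x []]]]] // _.
  rewrite !addn_eq0 !sqdist_eq0 muln_eq0 !addn_eq0 /=.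
  move: (e i) (e j) => a b; apply/idP/eqP => [|[-> -> -> ->]].
    case/andP=> /andP[/eqP Ea /eqP Eb] /orP[/eqP x0|/andP[/andP[/eqP s0 /eqP b0] /eqP y0]].
      have ltr : r < b by lia.
      rewrite /w Ea mulnC divnMDl ?modnMDl ?modn_small ?divn_small //; last by lia.
      by congr [:: _; _; _; _]; lia.
    by rewrite /w Ea b0 y0 !mul0n divn0 modn0 s0; congr [:: _; _; _; _]; lia.
  rewrite {1}(divn_eq a b) mulnC eqxx /=; apply/andP; split; first by lia.
  case: (posnP b) => [->|b0]; first by rewrite divn0 sub0n eqxx orbT.
  by apply/orP; left; rewrite subn_eq0 ltn_mod.
- apply: term_add (term_const 2); apply: term_add; exact: term_var.
- by move=> e e' le; rewrite leq_add2r leq_add.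
- move=> e; rewrite /w /=; have := leq_mod (e i) (e j); have := leq_div (e i) (e j); lia.
Qed.

(** The values of [g], [f] and [op] are pushed in this order, hence the shift in the hypothesis on
    [f]; the renaming hides the two intermediate values from [K]. *)
Lemma zero_counting_op2 (op : nat -> nat -> nat) f g :
  zero_counting_op (fun e => op (e 0) (e 1)) ->
  zero_counting_op (fun e => f (sdrop 1 e)) -> zero_counting_op g ->
  zero_counting_op (fun e => op (f e) (g e)).
Proof.
move=> cop cf cg K cK.
have := cg _ (cf _ (cop _ (zero_counting_rename (fun i => if i is i'.+1 then i'.+3 else 0) cK))).
by congr zero_counting; apply/funext => e; congr K; apply/funext => -[|i].
Qed.

Lemma zero_counting_op_term f : term f -> zero_counting_op f.
Proof.
(* The renaming lets subterms be evaluated beneath values already pushed. *)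
suff H r : term f -> zero_counting_op (fun e => f (e \o r)) by exact: (H id).
move=> tf; elim: tf r => {f} [n|i|f g _ IHf _ IHg|f g _ IHf _ IHg|f g _ IHf _ IHg
  |f g _ IHf _ IHg|f _ IHf] r.
- exact/zero_counting_op_exppoly/exppoly_coef/term_const.
- exact/zero_counting_op_exppoly/exppoly_var.
- apply: (zero_counting_op2 _ (IHf (succn \o r)) (IHg r)).
  by apply: zero_counting_op_exppoly; apply: exppoly_add; exact: exppoly_var.
- exact: (zero_counting_op2 (zero_counting_op_sub 0 1) (IHf (succn \o r)) (IHg r)).
- apply: (zero_counting_op2 _ (IHf (succn \o r)) (IHg r)).
  by apply: zero_counting_op_exppoly; apply: exppoly_mul; exact: exppoly_var.
- exact: (zero_counting_op2 (zero_counting_op_div 0 1) (IHf (succn \o r)) (IHg r)).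
- apply: (zero_counting_op2 (op := fun a _ => 2 ^ a) _ (IHf (succn \o r)) (IHf r)).
  exact/zero_counting_op_exppoly/exppoly_exp2.
Qed.

Theorem term_bounded_sum f g : term f -> term g ->
  term (fun e => \sum_(i < g e) f (scons i e)).
Proof.
move=> tf tg.
(* [f e] is a sum of [f e] ones: its value is pushed as variable 0, which then bounds a sum of 1. *)
have cf : zero_counting f.
  have := zero_counting_op_term tf (zero_counting_bounded_sum 0 zero_counting1).
  by congr zero_counting; apply/funext => e; rewrite sum1_card card_ord.
(* Variable 0 is here the bound, later replaced by [g e]; the renaming makes [f] skip it. *)
have tS := zero_counting_term (zero_counting_bounded_sum 0 (zero_counting_rename
  (fun i => if i is i'.+1 then i'.+2 else 0) cf)).
have ts i : term (fun e => scons (g e) e i) by case: i => // i; exact: term_var.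
apply: (eq_term (term_subst tS ts)) => e /=; apply: eq_bigr => i _.
by congr f; apply/funext => -[].
Qed.

(** * Bounded recursion *)

Definition digit W B i := W %/ B ^ i %% B.

(** The base exceeds the sum of all digits, as [coefficient_extraction] requires. *)
Lemma exists_digits n (a : nat -> nat) B : (forall i, i < n -> a i < B) ->
  exists2 W, W < (n * B).+1 ^ n.+1 & forall i, i < n -> digit W (n * B).+1 i = a i.
Proof.
move=> ltB; set X := (n * B).+1.
have sumX : \sum_(i < n) a i < X.
  rewrite ltnS -[n in n * _]card_ord -sum_nat_const.
  by apply: leq_sum => i _; rewrite ltnW ?ltB.
exists (\sum_(i < n) a i * X ^ i) => [|i lti].
  apply: (@leq_ltn_trans ((\sum_(i < n) a i) * X ^ n)).
    rewrite big_distrl; apply: leq_sum => i _.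
    by rewrite leq_mul2l leq_pexp2l ?orbT // ltnW.
  by rewrite expnS ltn_pmul2r // expn_gt0.
rewrite /digit (@coefficient_extraction _ (fun i : 'I_n => a i) (fun i : 'I_n => i)) //.
by rewrite (big_pred1 (Ordinal lti)).
Qed.

Definition dist x y := (x - y) + (y - x).

Lemma dist_eq0 x y : (dist x y == 0) = (x == y).
Proof. by rewrite addn_eq0 !subn_eq0 eqn_leq. Qed.

Lemma term_dist f g : term f -> term g -> term (fun e => dist (f e) (g e)).
Proof. by move=> tf tg; apply: term_add; exact: term_sub. Qed.

Lemma eq_in_mkseq k (f g : nat -> nat) :
  (forall i, i < k -> f i = g i) -> mkseq f k = mkseq g k.
Proof. by move=> fg; apply/eq_in_map => i; rewrite mem_iota => /fg. Qed.

Definition run k (init step : nat -> env -> nat) (e : env) n : seq nat :=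
  iter n (fun s => mkseq (fun j => step j (scat s e)) k) (mkseq (init^~ e) k).

Lemma term_sdrop f m : term f -> term (fun e => f (sdrop m e)).
Proof.
by move=> tf; apply: (term_subst (s := sdrop m)) => // i; exact: term_var.
Qed.

(** The digits of [W] list the states at all times up to [N], and [err] adds up the violations of
    the recursion. All [W] without error give the same value, so it is the sum of [val] over these
    [W] divided by their number, which is positive. *)
Theorem term_run k (init step : nat -> env -> nat) N B j :
  (forall i, i < k -> term (init i)) -> (forall i, i < k -> term (step i)) ->
  term N -> term B ->
  (forall e n i, n <= N e -> i < k -> nth 0 (run k init step e n) i < B e) ->
  j < k -> term (fun e => nth 0 (run k init step e (N e)) j).
Proof.
move=> tinit tstep tN tB ltB ltj.
pose len e := (N e).+1 * k.
have tlen : term len.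
  apply: term_mul (term_const k).
  by apply: (eq_term (term_add tN (term_const 1))) => e; rewrite addn1.
pose X e := (len e * B e).+1.
have tX : term X.
  by apply: (eq_term (term_add (term_mul tlen tB) (term_const 1))) => e; rewrite addn1.
have tdigit W Y i : term W -> term Y -> term i -> term (fun e => digit (W e) (Y e) (i e)).
  by move=> tW tY ti; apply: term_mod => //; apply: term_div => //; exact: term_expn.
pose state W e n := mkseq (fun i => digit W (X e) (n * k + i)) k.
pose err0 i W e := dist (digit W (X e) i) (init i e).
pose err1 i n W e := dist (digit W (X e) (n.+1 * k + i)) (step i (scat (state W e n) e)).
pose err W e := \sum_(i < k) err0 i W e + \sum_(n < N e) \sum_(i < k) err1 i n W e.
have terr0 i : i < k -> term (fun e => err0 i (e 0) (sdrop 1 e)).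
  move=> lti; apply: term_dist; last exact/term_sdrop/tinit.
  by apply: tdigit; [exact: term_var|exact: term_sdrop|exact: term_const].
have terr1 i : i < k -> term (fun e => err1 i (e 0) (e 1) (sdrop 2 e)).
  move=> lti; have tb n l : term n -> term (fun e => digit (e 1) (X (sdrop 2 e)) (n e * k + l)).
    move=> tn; apply: tdigit; [exact: term_var|exact: term_sdrop|].
    apply: term_add (term_const l); exact: term_mul (term_const k).
  apply: term_dist.
    apply: (eq_term (tb (fun e => e 0 + 1) i _)) => [|e]; last by rewrite addn1.
    exact: term_add (term_var 0) (term_const 1).
  apply: (term_subst (s := fun e => scat (state (e 1) (sdrop 2 e) (e 0)) (sdrop 2 e))).
    exact: tstep.
  move=> l; have [ltl|lel] := ltnP l k.
    apply: (eq_term (tb _ l (term_var 0))) => e.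
    by rewrite scatE size_mkseq ltl nth_mkseq.
  apply: (eq_term (term_var (2 + (l - k)))) => e.
  by rewrite scatE size_mkseq ltnNge lel.
have terr : term (fun e => err (e 0) (sdrop 1 e)).
  apply: term_add; first exact: (term_sum_ord terr0).
  apply: (eq_term (term_bounded_sum (term_sum_ord terr1) (term_sdrop 1 tN))) => e.
  by apply: eq_bigr => n _.
have errP W e : (err W e == 0) = [forall i : 'I_k, err0 i W e == 0] &&
    [forall n : 'I_(N e), forall i : 'I_k, err1 i n W e == 0].
  rewrite addn_eq0 !sum_nat_eq0; congr (_ && _); apply: eq_forallb => n.
  by rewrite sum_nat_eq0.
have err_run W e : err W e = 0 -> forall n, n <= N e -> state W e n = run k init step e n.
  move=> /eqP; rewrite errP => /andP[/forallP I0 /forallP S0].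
  elim=> [_|n IHn ltn] /=.
    apply: eq_in_mkseq => i lti; apply/eqP; rewrite -dist_eq0.
    exact: (I0 (Ordinal lti)).
  rewrite -IHn; last exact: ltnW.
  apply: eq_in_mkseq => i lti; apply/eqP; rewrite -dist_eq0.
  exact: (forallP (S0 (Ordinal ltn)) (Ordinal lti)).
have exW e : exists2 W, W < X e ^ (len e).+1 & err W e = 0.
  have ltlen n i : n <= N e -> i < k -> n * k + i < len e.
    move=> leN lti; apply: leq_trans (leq_mul (_ : n.+1 <= _) (leqnn k)) => //.
    by rewrite mulSn addnC ltn_add2r.
  have [|W ltW digW] := @exists_digits (len e)
      (fun l => nth 0 (run k init step e (l %/ k)) (l %% k)) (B e).
    move=> l ltl; apply: ltB; last by rewrite ltn_mod; case: (k) ltj.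
    by rewrite -ltnS ltn_divLR //; case: (k) ltj.
  exists W => //.
  have digE n i : n <= N e -> i < k ->
      digit W (X e) (n * k + i) = nth 0 (run k init step e n) i.
    move=> leN lti; rewrite digW ?ltlen // divnMDl; last by case: (k) ltj.
    by rewrite divn_small // addn0 modnMDl modn_small.
  apply/eqP; rewrite errP; apply/andP; split.
    apply/forallP => i; rewrite dist_eq0.
    by have := @digE 0 i; rewrite mul0n add0n => -> //; rewrite nth_mkseq.
  apply/forallP => n; apply/forallP => i; rewrite dist_eq0 digE //= nth_mkseq //.
  have -> // : state W e n = run k init step e n.
  have sz : size (run k init step e n) = k by case: (n : nat) => *; rewrite size_mkseq.
  apply: (@eq_from_nth _ 0) => [|l]; rewrite size_mkseq ?sz // => ltl.
  by rewrite nth_mkseq // digE // ltnW.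
pose val W e := digit W (X e) (N e * k + j).
have tval : term (fun e => val (e 0) (sdrop 1 e)).
  apply: tdigit; [exact: term_var|exact: term_sdrop|].
  apply: term_add (term_const j); apply: term_mul (term_const k); exact: term_sdrop.
(* By truncation, this is the indicator of [err = 0]. *)
have tok : term (fun e => 1 - err (e 0) (sdrop 1 e)) by exact: term_sub (term_const 1) terr.
have tR : term (fun e => X e ^ (len e).+1).
  apply: term_expn => //.
  by apply: (eq_term (term_add tlen (term_const 1))) => e; rewrite addn1.
apply: (eq_term (term_div (term_bounded_sum (term_mul tok tval) tR) (term_bounded_sum tok tR))).
move=> e /=; rewrite (eq_bigr (fun W : 'I__ => (1 - err W e) * nth 0 (run k init step e (N e)) j)).
  rewrite -big_distrl /= mulKn //; have [W ltW errW] := exW e.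
  by rewrite (bigD1 (Ordinal ltW)) //= errW.
move=> W _; have [err0W|err1W] := posnP (err W e); last first.
  have -> : 1 - err W e = 0 by apply/eqP; rewrite subn_eq0.
  by rewrite !mul0n.
by congr (_ * _); rewrite -(err_run W) // nth_mkseq.
Qed.

(** * Orbits of z^2 + c *)

(* An environment lists the index n of a point followed by N, xp, xm, yp, ym, u, wp, wm, vp, vm,
   t, a, b; in a step it is preceded by the current point ((x+ - x-) + i (y+ - y-)) / d, stored
   as x+, x-, y+, y-, d. *)
Definition orbit_init j (e : env) := e j.+2.

(** For [z = Z / d] and [c = C / t], the next point is [(t Z^2 + d^2 C) / (t d^2)], with positive
    and negative parts collected separately. *)
Definition orbit_step j (e : env) :=
  let d2 := e 4 * e 4 in
  match j with
  | 0 => e 16 * (e 0 * e 0 + e 1 * e 1 + 2 * (e 2 * e 3)) + d2 * e 12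
  | 1 => e 16 * (2 * (e 0 * e 1) + e 2 * e 2 + e 3 * e 3) + d2 * e 13
  | 2 => e 16 * (2 * (e 0 * e 2 + e 1 * e 3)) + d2 * e 14
  | 3 => e 16 * (2 * (e 0 * e 3 + e 1 * e 2)) + d2 * e 15
  | _ => e 16 * d2
  end.

Definition orbit_state := run 5 orbit_init orbit_step.

Ltac solve_term := repeat first
  [exact: term_const | exact: term_var | apply: term_add | apply: term_mul
  | apply: term_sub | assumption].

Lemma size_orbit_state e n : size (orbit_state e n) = 5.
Proof. by case: n => *; rewrite size_mkseq. Qed.

Lemma orbit_stateS e n j : j < 5 ->
  nth 0 (orbit_state e n.+1) j = orbit_step j (scat (orbit_state e n) e).
Proof. exact: nth_mkseq. Qed.

(** If [S] bounds a state, [T ^ 4 * S ^ 2] bounds the next; thus [S * T ^ 4] is squared at each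
    step, starting from [T ^ 5]. *)
Lemma orbit_state_bound (e : env) n j (T := \sum_(i < 12) e i + 2) : j < 5 ->
  nth 0 (orbit_state e n) j < (T ^ (5 * 2 ^ n)).+1.
Proof.
have leT i : i < 12 -> e i <= T.
  by move=> lti; rewrite /T (bigD1 (Ordinal lti)) //= -addnA leq_addr.
have T2 : 2 <= T by rewrite leq_addl.
clearbody T.
suff [S leS leST] : exists2 S, forall j, j < 5 -> nth 0 (orbit_state e n) j <= S &
    S * T ^ 4 <= T ^ (5 * 2 ^ n).
  move=> /leS le; rewrite ltnS (leq_trans le) // (leq_trans _ leST) //.
  by rewrite leq_pmulr // expn_gt0 (ltnW T2).
elim: n {j} => [|n [S leS leST]].
  exists T => [j ltj|]; last by rewrite -expnS.
  by rewrite nth_mkseq //; apply: leT; case: j ltj => [|[|[|[|[]]]]].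
exists (T ^ 4 * (S * S)); last first.
  have -> : 5 * 2 ^ n.+1 = 5 * 2 ^ n + 5 * 2 ^ n by rewrite expnS; lia.
  rewrite expnD; apply: leq_trans (leq_mul leST leST).
  by move: (T ^ 4) => P; rewrite leq_eqVlt; apply/orP; left; apply/eqP; ring.
move=> j ltj; rewrite orbit_stateS //.
(* Components are at most [T * (4 * S ^ 2) + S ^ 2 * T], and [5 <= T ^ 3] since [T >= 2]. *)
have T4 : 5 * T <= T ^ 4.
  rewrite expnSr leq_mul2r; apply/orP; right.
  by apply: leq_trans (_ : 2 ^ 3 <= _) => //; rewrite leq_exp2r.
apply: leq_trans (leq_mul T4 (leqnn (S * S))).
case: (orbit_state e n) (size_orbit_state e n) leS => [|x [|y [|z [|w [|d [|]]]]]] // _ leS.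
have [lx ly lz lw ld] : [/\ x <= S, y <= S, z <= S, w <= S & d <= S].
  by split; [exact: (leS 0)|exact: (leS 1)|exact: (leS 2)|exact: (leS 3)|exact: (leS 4)].
have M u v : u <= S -> v <= S -> u * v <= S * S by move=> *; exact: leq_mul.
have key t w' A d2 : t <= T -> w' <= T -> A <= 4 * (S * S) -> d2 <= S * S ->
    t * A + d2 * w' <= 5 * T * (S * S).
  move=> lt lw' lA ld2; apply: leq_trans (leq_add (leq_mul lt lA) (leq_mul ld2 lw')) _.
  by rewrite leq_eqVlt; apply/orP; left; apply/eqP; ring.
have [t11 t7 t8 t9 t10] : [/\ e 11 <= T, e 7 <= T, e 8 <= T, e 9 <= T & e 10 <= T].
  by split; exact: leT.
have Mx := M x _ lx; have My := M y _ ly; have Mz := M z _ lz; have Mw := M w _ lw.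
case: j ltj => [|[|[|[|[|]]]]] //= _.
- by apply: key; rewrite ?M //; have := Mx x lx; have := My y ly; have := Mz w lw; lia.
- by apply: key; rewrite ?M //; have := Mx y ly; have := Mz z lz; have := Mw w lw; lia.
- by apply: key; rewrite ?M //; have := Mx z lz; have := My w lw; lia.
- by apply: key; rewrite ?M //; have := Mx w lw; have := My z lz; lia.
- rewrite -[leqLHS]addn0; apply: (key (e 11) 0 (d * d) 0) => //.
  by apply: leq_trans (M d d ld ld) _; exact: leq_pmull.
Qed.

Lemma term_orbit_state j : j < 5 -> term (fun e => nth 0 (orbit_state e (e 0)) j).
Proof.
move=> ltj; pose T (e : env) := \sum_(i < 12) e i + 2.
apply: (@term_run 5 _ _ (fun e => e 0) (fun e => (T e ^ (5 * 2 ^ e 0)).+1)) => //.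
- by move=> i _; exact: term_var.
- by move=> [|[|[|[|i]]]] _; rewrite /orbit_step; solve_term.
- exact: term_var.
- have tT : term T by apply: term_add (term_const 2);
    by apply: (term_sum_ord (F := fun i e => e i)) => i _; exact: term_var.
  apply: (eq_term (f := fun e => T e ^ (5 * 2 ^ e 0) + 1)) => [|e]; last by rewrite addn1.
  apply: term_add (term_const 1); apply: term_expn => //.
  by apply: term_mul (term_const 5) _; exact/term_exp2/term_var.
- move=> e n i len lti; apply: leq_trans (orbit_state_bound e n lti) _.
  by rewrite ltnS leq_pexp2l ?leq_mul2l ?leq_pexp2l // addn2.
Qed.

(** Together with [norm_rhs], this is [|z|^2 < (a/b)^2] cleared of denominators, the mixed products
    moved to the right to avoid subtraction. *)
Definition norm_lhs (e : env) (x : nat -> nat) :=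
  e 13 * e 13 * (x 0 * x 0 + x 1 * x 1 + (x 2 * x 2 + x 3 * x 3)).

Definition norm_rhs (e : env) (x : nat -> nat) :=
  e 12 * e 12 * (x 4 * x 4) + 2 * (e 13 * e 13) * (x 0 * x 1 + x 2 * x 3).

Definition inside (e : env) (s : seq nat) := norm_lhs e (nth 0 s) < norm_rhs e (nth 0 s).

Lemma term_inside_count :
  term (fun e => \sum_(n < e 0) inside (scons n e) (orbit_state (scons n e) n)).
Proof.
pose x e := nth 0 (orbit_state e (e 0)).
have [t0 t1 t2 t3 t4] : [/\ term (x^~ 0), term (x^~ 1), term (x^~ 2), term (x^~ 3) & term (x^~ 4)].
  by split; exact: term_orbit_state.
have tl : term (fun e => norm_lhs e (x e)) by rewrite /norm_lhs; solve_term.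
have tr : term (fun e => norm_rhs e (x e)) by rewrite /norm_rhs; solve_term.
have t : term (fun e => inside e (orbit_state e (e 0)) : nat).
  (* With truncation, [1 - (l + 1 - r)] is 1 if [l < r] and 0 otherwise. *)
  apply: (eq_term (term_sub (term_const 1) (term_sub (term_add tl (term_const 1)) tr))) => e.
  by rewrite /inside -/(x e); lia.
by apply: (eq_term (term_bounded_sum t (term_var 0))) => e; apply: eq_bigr.
Qed.

(** * Escape and colors over the complex numbers *)

Import Order.TTheory GRing.Theory Num.Theory.
Local Open Scope ring_scope.
Local Open Scope complex_scope.

Definition gauss_state (R : rcfType) (s : seq nat) : R[i] :=
  let x := nth 0%N s in gauss_frac R (x 0) (x 1) (x 2) (x 3) (x 4).

Lemma gauss_fracE (R : rcfType) p q r s d :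
  gauss_frac R p q r s d = (p%:R - q%:R + 'i * (r%:R - s%:R)) / d%:R.
Proof. by rewrite /gauss_frac [_ +i* _]complexE /= !rmorphB !rmorph_nat. Qed.

Lemma orbit_state_denom_gt0 e n :
  (0 < e 6)%N -> (0 < e 11)%N -> (0 < nth 0 (orbit_state e n) 4)%N.
Proof.
move=> u0 t0; elim: n => [|n IHn]; first by rewrite nth_mkseq.
rewrite orbit_stateS //; case: (orbit_state e n) (size_orbit_state e n) IHn.
  by [].
move=> x [|y [|z [|w [|d [|]]]]] //= _ d0.
by rewrite !muln_gt0 t0 d0.
Qed.

Lemma orbit_pt_state (R : rcfType) e n : (0 < e 6)%N -> (0 < e 11)%N ->
  orbit_pt (gauss_frac R (e 7) (e 8) (e 9) (e 10) (e 11))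
    (gauss_frac R (e 2) (e 3) (e 4) (e 5) (e 6)) n = gauss_state R (orbit_state e n).
Proof.
move=> u0 t0; elim: n => [|n IHn]; first by rewrite /gauss_state !nth_mkseq.
rewrite /orbit_pt iterS -/(orbit_pt _ _ n) IHn /gauss_state !orbit_stateS //.
have := orbit_state_denom_gt0 n u0 t0.
case: (orbit_state e n) (size_orbit_state e n) => [//|x [|y [|z [|w [|d [|]]]]]] //= _ d0.
rewrite !gauss_fracE !(natrD, natrM).
have dn0 : d%:R != 0 :> R[i] by rewrite pnatr_eq0 -lt0n.
have tn0 : (e 11)%:R != 0 :> R[i] by rewrite pnatr_eq0 -lt0n.
have sq (A B : R[i]) : (A + 'i * B) ^+ 2 = A ^+ 2 - B ^+ 2 + 'i * (2 * (A * B)).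
  by rewrite sqrrD exprMn sqr_i; ring.
by rewrite expr_div_n sq; field; rewrite dn0 tn0.
Qed.

Lemma normc_gauss_frac (R : rcfType) p q r s d :
  `|gauss_frac R p q r s d| =
  (Num.sqrt ((p%:R - q%:R) ^+ 2 + (r%:R - s%:R) ^+ 2) / d%:R)%:C.
Proof. by rewrite /gauss_frac normf_div normc_def normr_nat /= fmorph_div /= rmorph_nat. Qed.

Lemma escaped_state (R : rcfType) e n : (0 < e 6)%N -> (0 < e 11)%N -> (0 < e 13)%N ->
  escaped (gauss_frac R (e 7) (e 8) (e 9) (e 10) (e 11)) ((e 12)%:R / (e 13)%:R)
    (gauss_frac R (e 2) (e 3) (e 4) (e 5) (e 6)) n = ~~ inside e (orbit_state e n).
Proof.
move=> u0 t0 b0; rewrite /escaped orbit_pt_state // normc_gauss_frac lecR.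
have := orbit_state_denom_gt0 n u0 t0; rewrite /inside -leqNgt.
move: (nth _ _) => x d0; rewrite /norm_lhs /norm_rhs -(ler_nat R) !(natrD, natrM).
set S := (_ ^+ 2 + _ ^+ 2).
have S0 : 0 <= S by rewrite addr_ge0 ?sqr_ge0.
rewrite ler_pdivrMr ?ltr0n // mulrAC ler_pdivlMr ?ltr0n //.
rewrite -[LHS]ler_sqr ?nnegrE ?mulr_ge0 ?ler0n ?sqrtr_ge0 //.
rewrite !exprMn sqr_sqrtr // -[LHS]subr_ge0 -[RHS]subr_ge0; congr (0 <= _).
by rewrite /S; ring.
Qed.

(** [|z^2 + c| >= |z|^2 - |c| >= r^2 - (r^2 - r) = r]. *)
Lemma escaped_step (R : rcfType) (c z : R[i]) (r : R) : 0 <= r ->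
  `|c| <= (r ^+ 2 - r)%:C -> r%:C <= `|z| -> r%:C <= `|z ^+ 2 + c|.
Proof.
move=> r0 lec lez; apply: le_trans (lerB_normD _ _); rewrite normrX.
rewrite lerBrDr; apply: le_trans (lerD (lexx _) lec) _.
rewrite -rmorphD /= addrC subrK rmorphXn /= lerXn2r // nnegrE //.
by rewrite ler0c.
Qed.

(** Escape is permanent, so the points counted are those before the first escape; if there is none
    up to [N], all [N] are counted, which is the default color. *)
Lemma color_count (R : rcfType) (c z0 : R[i]) (r : R) N :
  (forall n, escaped c r z0 n -> escaped c r z0 n.+1) ->
  color c r N z0 = (\sum_(n < N) ~~ escaped c r z0 n)%N.
Proof.
rewrite /color; move: (escaped c r z0) => P PS.
have Pmono m n : (m <= n)%N -> P m -> P n.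
  by move=> le Pm; rewrite -(subnKC le); elim: (n - m)%N => [|k /PS]; rewrite ?addn0 ?addnS.
set k := find P _; have [lekN|ltNk] := leqP k N; last first.
  have noP : ~~ has P (iota 0 N.+1) by rewrite has_find size_iota -leqNgt.
  rewrite (eq_bigr (fun=> 1%N)) => [|i _]; first by rewrite sum1_card card_ord.
  suff -> : ~~ P i by [].
  by apply: contra noP => Pi; apply/hasP; exists (i : nat); rewrite // mem_iota /= add0n ltnS ltnW.
have Pk : P k.
  have hasP : has P (iota 0 N.+1) by rewrite has_find size_iota ltnS.
  by have := nth_find 0%N hasP; rewrite nth_iota.
have Pn n : (n < N)%N -> ~~ P n = (n < k)%N.
  move=> ltn; have [lek|ltk] := leqP k n; first by rewrite (Pmono k).
  by have := before_find 0%N ltk; rewrite nth_iota ?add0n ?ltnS ?(ltnW ltn) // => ->.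
rewrite (eq_bigr (fun i : 'I_N => nat_of_bool (i < k)%N)) => [|i _]; last by rewrite Pn.
rewrite -[k in LHS]card_ord -sum1_card (big_ord_widen _ (fun=> 1%N) lekN) big_mkcond.
by apply: eq_bigr => i _; case: ifP.
Qed.

(** Induction on [|c| <= |z(n+1)|], from [z(1) = c]: [|z^2 + c| >= |c|^2 - |c| >= |c|] since
    [|c| > 2]. *)
Lemma escaped_step_large_c (R : rcfType) (c : R[i]) n : ~~ (`|c| <= 2%:R%:C) ->
  escaped c 2%:R 0 n.+1.
Proof.
rewrite -real_ltNge ?realE ?normr_ge0 ?ler0c ?ler0n // => lt2c.
apply: le_trans (ltW lt2c) _.
elim: n => [|n IHn]; first by rewrite /orbit_pt /= expr0n add0r.
rewrite /orbit_pt iterS -/(orbit_pt c 0 n.+1); apply: le_trans (lerB_normD _ _).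
rewrite normrX lerBrDr; apply: le_trans (_ : `|c| ^+ 2 <= _); last by rewrite lerXn2r ?nnegrE.
by rewrite -mulr2n -mulr_natl expr2 ler_wpM2r // -(rmorph_nat (real_complex R)) ltW.
Qed.

Theorem mainTheorem9 :
  exists V : aterm 13,
    forall R : realType,
      (forall N xp xm yp ym u wp wm vp vm t a b : nat,
         (0 < u)%N -> (0 < t)%N -> (0 < a)%N -> (0 < b)%N ->
         let z0 : R[i] := gauss_frac R xp xm yp ym u in
         let c : R[i] := gauss_frac R wp wm vp vm t in
         let r : R := a%:R / b%:R in
         `|c| <= (r ^+ 2 - r)%:C ->
         `|z0| < r%:C ->
         aeval [tuple N; xp; xm; yp; ym; u; wp; wm; vp; vm; t; a; b] V
           = color c r N z0)
      /\
      (forall N wp wm vp vm t : nat,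
         (0 < t)%N ->
         let c : R[i] := gauss_frac R wp wm vp vm t in
         aeval [tuple N; 0; 0; 0; 0; 1; wp; wm; vp; vm; t; 2; 1]%N V
           = color c 2%:R N 0).
Proof.
have [V HV] := term_aterm 13 term_inside_count; exists V => R.
have evalV N xp xm yp ym u wp wm vp vm t a b : (0 < u)%N -> (0 < t)%N -> (0 < b)%N ->
    let z0 := gauss_frac R xp xm yp ym u in
    let c := gauss_frac R wp wm vp vm t in
    let r := a%:R / b%:R in
    (forall n, escaped c r z0 n -> escaped c r z0 n.+1) ->
    aeval [tuple N; xp; xm; yp; ym; u; wp; wm; vp; vm; t; a; b] V = color c r N z0.
  move=> u0 t0 b0 z0 c r mono_esc; rewrite color_count // HV.
  apply: eq_bigr => n _; set e := scons _ _.
  by rewrite -[inside _ _]negbK -(escaped_state R (e := e)).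
split=> [N xp xm yp ym u wp wm vp vm t a b u0 t0 a0 b0 z0 c r lec _|N wp wm vp vm t t0 c].
  apply: evalV => // n; rewrite /escaped /orbit_pt iterS.
  by apply: escaped_step lec; rewrite divr_ge0.
have z0E : gauss_frac R 0 0 0 0 1 = 0 by rewrite gauss_fracE subrr mulr0 addr0 mul0r.
have rE : 2%:R / 1%:R = 2%:R :> R by rewrite divr1.
(* For [r = 2] the bound [r^2 - r] equals 2, so [escaped_step] covers the case [|c| <= 2]. *)
rewrite evalV // z0E rE // => n; have [lec|/escaped_step_large_c//] := boolP (`|c| <= 2%:R%:C).
rewrite /escaped /orbit_pt iterS; apply: escaped_step => //.
by apply: le_trans lec _; rewrite lecR expr2 mulr_natl mulr2n addrK.
Qed.
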